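(* Let $L\ge 1$ be an integer, let $\alpha_1,\dots,\alpha_L\in\{0,x,y,z\}$ be fixed, and for every odd integer $N\geq L$ let $A=\sigma_1^{\alpha_1}\sigma_2^{\alpha_2}\cdots\sigma_L^{\alpha_L}$ be the corresponding product of Pauli operators on the ring of $N$ spins. Then there exist positive constants $C_1,C_2$ independent of $N$ such that for every odd $N\ge L$, all momenta $p_1,p_2\in\{2\pi k/N: k=0,1,\dots,N-1\}$ (not necessarily different), and all complex numbers $u_1,v_1,u_2,v_2$ with $|u_j|^2+|v_j|^2=1$ for $j=1,2$, the states $|g_j\rangle=(u_j\mathbf 1+v_j\Pi^z)|s_{p_j}\rangle$, $j=1,2$, satisfy: (a) if $\alpha_j\in\{0,x\}$ for all $j\in\{1,\dots,L\}$, with $\alpha_j=x$ for an odd number of sites $j$, then $$|\langle g_1|A|g_2\rangle|\le \frac{C_1}{N\,\left|\cos\frac{p_1-p_2}{2}\right|};$$ (b) if there is at least one site $j\in\{1,\dots,L\}$ with $\alpha_j\in\{y,z\}$, then $$|\langle g_1|A|g_2\rangle|\le \frac{C_2}{N}.$$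
   Context: Consider a ring of $N$ spins $1/2$, $N$ odd, with Hilbert space $(\mathbb C^2)^{\otimes N}$. For $\alpha\in\{x,y,z\}$, $\sigma_j^\alpha$ denotes the Pauli matrix $\sigma^\alpha$ acting on the $j$-th tensor factor, with periodic indices $\sigma^\alpha_{j+N}=\sigma^\alpha_j$; $\sigma_j^0$ is the identity. The parity operators are $\Pi^\alpha=\bigotimes_{j=1}^N\sigma_j^\alpha$. Let $|\pm\rangle$ be the normalized eigenvectors of $\sigma^x$ with eigenvalues $\pm1$, with phases chosen so that $\sigma^z|\pm\rangle=|\mp\rangle$. Kink states: for $j\in\{1,\dots,N\}$, $|j\rangle$ is the product state, with each spin equal to $|+\rangle$ or $|-\rangle$, in which spins $j$ and $j+1$ (indices mod $N$) are both $|+\rangle$ and every other pair of neighbouring spins on the ring consists of opposite spins. (Thus $|N\rangle=|+-+-\cdots+-+\rangle$, and $|j\rangle$ is obtained from $|N\rangle$ by cyclically shifting the spin configuration by $j$ sites to the right.) The state $\Pi^z|j\rangle$ is obtained from $|j\rangle$ by flipping all spins. For $p=2\pi k/N$, $k\in\{0,\dots,N-1\}$, define $$|s_p\rangle=\frac1{\sqrt N}\sum_{j=1}^N e^{\imath p j}|j\rangle .$$ Since $N$ is odd, $p_1-p_2$ is never an odd multiple of $\pi$, so $\cos\frac{p_1-p_2}{2}\ne0$. *)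

(* Defs.v *)
From HB Require Import structures.
From mathcomp Require Import all_boot all_order all_algebra.
From mathcomp Require Import complex.
From mathcomp Require Import reals trigo.
From mathcomp Require Import zify.

Set Implicit Arguments.
Unset Strict Implicit.
Unset Printing Implicit Defensive.

Import Order.TTheory GRing.Theory Num.Theory.

Local Open Scope ring_scope.
Local Open Scope complex_scope.

Inductive pauli_label := P0 | Px | Py | Pz.

Definition pauli_label_eqb (a b : pauli_label) : bool :=
  match a, b with
  | P0, P0 | Px, Px | Py, Py | Pz, Pz => true
  | _, _ => false
  end.

Lemma pauli_label_eqP : Equality.axiom pauli_label_eqb.
Proof. by case=> [] []; constructor. Qed.

HB.instance Definition _ := hasDecEq.Build pauli_label pauli_label_eqP.

Definition mx2 (K : Type) (a b c d : K) : 'M[K]_2 :=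
  \matrix_(i, j) if i == 0 then (if j == 0 then a else b)
                 else (if j == 0 then c else d).

Definition pauli (R : realType) (a : pauli_label) : 'M[R[i]]_2 :=
  match a with
  | P0 => 1%:M
  | Px => mx2 0 1 1 0
  | Py => mx2 0 (- 'i) 'i 0
  | Pz => mx2 1 0 0 (- 1)
  end.

(* The space of N spins is the space of column vectors whose coordinates are
   indexed, through [enum_val], by the configurations ['I_N -> {0, 1}], that is
   by the product basis built on the basis of C^2 diagonalizing sigma^z. *)
Notation cfg N := {ffun 'I_N -> 'I_2}.
Notation state R N := 'cV[R[i]]_#|{: cfg N}|.
Notation operator R N := 'M[R[i]]_#|{: cfg N}|.

Definition braket (R : realType) (n : nat) (u v : 'cV[R[i]]_n) : R[i] :=
  (map_mx Num.conj u^T *m v) 0 0.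

Definition tensor_ket (R : realType) (N : nat) (v : 'I_N -> 'cV[R[i]]_2) :
    state R N :=
  \col_s \prod_(i < N) v i ((enum_val s : cfg N) i) 0.

Definition tensor_op (R : realType) (N : nat) (M : 'I_N -> 'M[R[i]]_2) :
    operator R N :=
  \matrix_(s, t)
    \prod_(i < N) M i ((enum_val s : cfg N) i) ((enum_val t : cfg N) i).

(* Sites are numbered from 1 and modulo N: [i : 'I_N] is the site i + 1. *)
Definition sigma (R : realType) (N j : nat) (a : pauli_label) : operator R N :=
  tensor_op (fun i : 'I_N =>
    if i.+1 == j %[mod N] then pauli R a else 1%:M).

Definition parity (R : realType) (N : nat) (a : pauli_label) : operator R N :=
  tensor_op (fun _ : 'I_N => pauli R a).

Definition pauli_string (R : realType) (N L : nat)
    (alpha : 'I_L -> pauli_label) : operator R N :=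
  \prod_(j < L) sigma R N j.+1 (alpha j).

(* These conditions determine the pair (|+>, |->) up to a common phase. *)
Record x_eigenbasis (R : realType) (ketp ketm : 'cV[R[i]]_2) : Prop := {
  ketp_eigen : pauli R Px *m ketp = ketp;
  ketm_eigen : pauli R Px *m ketm = - ketm;
  ketp_norm : braket ketp ketp = 1;
  ketm_norm : braket ketm ketm = 1;
  ketp_flip : pauli R Pz *m ketp = ketm;
  ketm_flip : pauli R Pz *m ketm = ketp
}.

(* [true] stands for |+>; the configuration + - + - ... + - + shifted by j
   sites to the right, for 1 <= j <= N. *)
Definition kink_plus (N j : nat) (i : 'I_N) : bool :=
  ~~ odd ((i + (N - j)) %% N).

Lemma kink_plus_ordS (N j : nat) (i : 'I_N) :
  odd N -> (0 < j <= N)%N ->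
  if i.+1 == j then kink_plus j i && kink_plus j (ordS i)
  else kink_plus j i != kink_plus j (ordS i).
Proof.
move=> oN /andP[j0 jN]; have iN := ltn_ord i.
rewrite /kink_plus /= modnDml addSn.
case: eqP => [ij|ij].
  have -> : (i + (N - j))%N = N.-1 by lia.
  by rewrite prednK ?modnn ?modn_small ?andbT; lia.
have [lt|ge] := ltnP (i + (N - j)).+1 N.
  by rewrite !modn_small ?(ltnW lt) //=; case: odd.
have -> : (i + (N - j))%N = (N + (i - j))%N by lia.
by rewrite -addnS !modnDl !modn_small /=; [case: odd|lia|lia].
Qed.

(* For odd N the kink pattern is the unique one in which the spins at sites
   j and j + 1 are both +, and all other neighbouring spins are opposite. *)
Lemma kink_plusP (N j : nat) (c : 'I_N -> bool) :
  odd N -> (0 < j <= N)%N ->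
  (c =1 kink_plus j) <->
  (forall i : 'I_N, if i.+1 == j then c i && c (ordS i)
                    else c i != c (ordS i)).
Proof.
move=> oN jN; split=> [ck i|cP i].
  by rewrite !ck; apply: kink_plus_ordS.
have [m] := ubnP ((i + (N - j)) %% N).
elim: m i => // m IHm i; rewrite ltnS -(ord_predK i).
set h := ord_pred i => hm.
have := cP h; have := kink_plus_ordS h oN jN.
case: eqP => [_ /andP[_ ->] /andP[_ ->] //|hj].
rewrite IHm; first by case: (c _) (kink_plus _ _) (kink_plus _ _) => [] [] [].
apply: leq_trans hm; rewrite [ordS h : nat]/= [X in (_ < X)%N]modnDml addSn.
have hN := ltn_ord h; case/andP: jN => j0 jN.
have [lt|ge] := ltnP (h + (N - j)).+1 N.
  by rewrite (modn_small lt) (modn_small (ltnW lt)).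
have -> : (h + (N - j))%N = (N + (h - j))%N by lia.
by rewrite -addnS !modnDl !modn_small; lia.
Qed.

Definition kink (R : realType) (N : nat) (ketp ketm : 'cV[R[i]]_2) (j : nat) :
    state R N :=
  tensor_ket (fun i : 'I_N => if kink_plus j i then ketp else ketm).

Definition expi (R : realType) (x : R) : R[i] := cos x +i* sin x.

Definition momentum (R : realType) (N k : nat) : R := 2 * pi * k%:R / N%:R.

Definition kink_momentum (R : realType) (N : nat) (ketp ketm : 'cV[R[i]]_2)
    (p : R) : state R N :=
  ((Num.sqrt N%:R)^-1)%:C *:
    \sum_(1 <= j < N.+1) expi (p * j%:R) *: kink N ketp ketm j.

Definition kink_ground (R : realType) (N : nat) (ketp ketm : 'cV[R[i]]_2)
    (u v : R[i]) (p : R) : state R N :=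
  (u%:M + v *: parity R N Pz) *m kink_momentum N ketp ketm p.

(* Main.v *)
Require Import Defs.
From HB Require Import structures.
From mathcomp Require Import all_boot all_order all_algebra.
From mathcomp Require Import complex.
From mathcomp Require Import reals trigo.
From mathcomp Require Import zify ring.

(** In the basis of products of |+> and |->, a Pauli string is a phase times the
    flip of the spins at the sites labelled y or z.
    If some spin is flipped, a matrix element between (possibly reversed) kink
    states is nonzero only if both kinks sit at one of the bonds 1, ..., L, N
    that touch the string, so at most (2(L+1))^2 terms of size 1/N contribute.
    If none is flipped, only the diagonal elements survive, and each step of the
    kink outside the string reverses an odd number of signs: the sum over the
    kink position is, up to L-1 terms, geometric with ratio -e^{i(p2-p1)}, and
    |1 + e^{iq}| = 2|cos(q/2)|. *)

Set Implicit Arguments.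
Unset Strict Implicit.
Unset Printing Implicit Defensive.

Import Order.TTheory GRing.Theory Num.Theory.

Local Open Scope ring_scope.
Local Open Scope complex_scope.

(** * Tensor products on the spin ring, and Pauli strings as such products *)

Section TensorProducts.
Variables (R : realType) (N : nat).
Implicit Types (u v : 'I_N -> 'cV[R[i]]_2) (M : 'I_N -> 'M[R[i]]_2).

(** Distributivity of products over sums, read along [enum_val]. The identities for operator
    products, operator action and inner products below all reduce to it. *)
Lemma sum_prod_cfg (F : 'I_N -> 'I_2 -> R[i]) :
  \sum_(s < #|{: cfg N}|) \prod_(i < N) F i ((enum_val s : cfg N) i) =
  \prod_(i < N) \sum_(b < 2) F i b.
Proof.
rewrite (bigA_distr_bigA F) /= (reindex (@enum_val _ (mem {: cfg N}))) //=.
exact: onW_bij (enum_val_bij _).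
Qed.

Lemma tensor_op_ket M v :
  tensor_op M *m tensor_ket v = tensor_ket (fun i => M i *m v i).
Proof.
apply/colP => s; rewrite !mxE.
rewrite -[RHS]/(\prod_(i < N) (M i *m v i) ((enum_val s : cfg N) i) 0).
under [RHS]eq_bigr do rewrite mxE.
rewrite -sum_prod_cfg; apply: eq_bigr => t _.
by rewrite !mxE -big_split.
Qed.

Lemma tensor_opM M M' :
  tensor_op M *m tensor_op M' = tensor_op (fun i => M i *m M' i).
Proof.
apply/matrixP => s t; rewrite !mxE.
under [RHS]eq_bigr do rewrite mxE.
rewrite -(sum_prod_cfg (fun i b => M i ((enum_val s : cfg N) i) b *
                           M' i b ((enum_val t : cfg N) i))).
by apply: eq_bigr => r _; rewrite !mxE -big_split.
Qed.

Lemma tensor_op1 : tensor_op (fun=> 1%:M) = 1%:M :> operator R N.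
Proof.
apply/matrixP => s t; rewrite !mxE.
have [->|st] := eqVneq s t; first by rewrite big1 // => i _; rewrite mxE eqxx.
have /forallPn[i sti] : ~~ [forall i, (enum_val s : cfg N) i == (enum_val t : cfg N) i].
  by apply: contra st => /forallP e; apply/eqP/enum_val_inj/ffunP => i; apply/eqP.
by rewrite (bigD1 i) //= mxE (negPf sti) mul0r.
Qed.

Lemma braket_tensor_ket u v :
  braket (tensor_ket u) (tensor_ket v) = \prod_(i < N) braket (u i) (v i).
Proof.
rewrite /braket !mxE; under [RHS]eq_bigr do rewrite mxE.
rewrite -sum_prod_cfg; apply: eq_bigr => s _.
by rewrite !mxE rmorph_prod -big_split; apply: eq_bigr => i _; rewrite !mxE.
Qed.

(** Extending the string by the identity to all of [nat] gives every site of the ring a label, with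
    no side condition relating [L] and [N]. *)
Definition pad (L : nat) (alpha : 'I_L -> pauli_label) (n : nat) : pauli_label :=
  if insub n is Some j then alpha j else P0.

Lemma pad_ord (L : nat) (alpha : 'I_L -> pauli_label) (j : 'I_L) :
  pad alpha j = alpha j.
Proof. by rewrite /pad valK. Qed.

Lemma pad_ge (L : nat) (alpha : 'I_L -> pauli_label) (n : nat) :
  (L <= n)%N -> pad alpha n = P0.
Proof. by move=> Ln; rewrite /pad insubF // ltnNge Ln. Qed.

(** Induction on the string: the new last factor acts on a site where the shorter string is padded
    by the identity, so each site meets at most one nontrivial factor. *)
Lemma pauli_stringE (L : nat) (alpha : 'I_L -> pauli_label) :
  (L <= N)%N ->
  pauli_string R N alpha = tensor_op (fun i => pauli R (pad alpha i)).
Proof.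
elim: L alpha => [|L IHL] alpha LN.
  rewrite /pauli_string big_ord0 -[1]/(1%:M) -tensor_op1.
  by apply/matrixP => s t; rewrite !mxE; apply: eq_bigr => i _; rewrite pad_ge.
rewrite /pauli_string big_ord_recr /=.
have := IHL (fun j => alpha (widen_ord (leqnSn L) j)) (ltnW LN).
rewrite /pauli_string /= => ->.
rewrite -[_ * _]/(_ *m _) tensor_opM; apply/matrixP => s t.
rewrite !mxE; apply: eq_bigr => i _.
(* Sites are numbered from 1, so site [N] reduces to 0; cancelling the successor first leaves two
   numbers below [N], where the congruence is an equality. *)
have -> : (i.+1 == L.+1 %[mod N]) = (i == L :> nat).
  by rewrite -[i.+1]addn1 -[L.+1]addn1 eqn_modDr !modn_small.
case: eqP => [iL|iL].
  by rewrite iL pad_ge // mul1mx -(pad_ord alpha ord_max).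
rewrite mulmx1; congr (pauli _ _ _ _).
have [iltL|] := ltnP i L; last by move=> ?; rewrite !pad_ge //; lia.
rewrite (pad_ord _ (Ordinal iltL)).
have iL1 : (i < L.+1)%N by lia.
by rewrite (pad_ord alpha (Ordinal iL1)); congr alpha; apply: val_inj.
Qed.

End TensorProducts.

(** * Single-spin matrix elements in the eigenbasis of sigma^x *)

Section XBasis.
Variables (R : realType) (ketp ketm : 'cV[R[i]]_2).
Hypothesis hket : x_eigenbasis ketp ketm.

Definition xket (b : bool) := if b then ketp else ketm.

Lemma sum_ord2 (V : nmodType) (F : 'I_2 -> V) : \sum_(i < 2) F i = F 0 + F 1.
Proof. by rewrite big_ord_recl big_ord1; congr (_ + F _); apply: val_inj. Qed.

Lemma braket2 (u v : 'cV[R[i]]_2) :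
  braket u v = Num.conj (u 0 0) * v 0 0 + Num.conj (u 1 0) * v 1 0.
Proof. by rewrite /braket !mxE sum_ord2 !mxE. Qed.

Lemma mulmx_cV2 (M : 'M[R[i]]_2) (v : 'cV[R[i]]_2) i :
  (M *m v) i 0 = M i 0 * v 0 0 + M i 1 * v 1 0.
Proof. by rewrite mxE sum_ord2. Qed.

(** The eigenvalue and flip equations force the coordinates (a, a) and (a, -a) with |a|^2 = 1/2.
    Only the common phase of [a] stays free, and it cancels in every inner product. *)
Lemma xket_coord : exists2 a : R[i], Num.conj a * a + Num.conj a * a = 1 &
  forall b, xket b 0 0 = a /\ xket b 1 0 = if b then a else - a.
Proof.
have p10 : ketp 1 0 = ketp 0 0.
  have /colP/(_ 0) := ketp_eigen hket.
  by rewrite mulmx_cV2 !mxE /= mul0r mul1r add0r.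
have m00 : ketm 0 0 = ketp 0 0.
  have /colP/(_ 0) := ketp_flip hket.
  by rewrite mulmx_cV2 !mxE /= mul0r mul1r addr0.
have m10 : ketm 1 0 = - ketp 0 0.
  have /colP/(_ 1) := ketp_flip hket.
  by rewrite mulmx_cV2 !mxE /= mul0r mulN1r add0r p10.
exists (ketp 0 0); last by case.
by have := ketp_norm hket; rewrite braket2 p10.
Qed.

Definition flips (a : pauli_label) := (a == Py) || (a == Pz).

Lemma pauli_Pz_xket b : pauli R Pz *m xket b = xket (~~ b).
Proof. by case: b => /=; [exact: ketp_flip hket|exact: ketm_flip hket]. Qed.

Lemma braket_pauli a b1 b2 :
  braket (xket b1) (pauli R a *m xket b2) =
  if b1 == b2 (+) flips a then
    match a with P0 | Pz => 1 | Px => (-1) ^+ (~~ b2) | Py => 'i%R * (-1) ^+ b2 end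
  else 0.
Proof.
have [z zz E] := xket_coord.
have E0 b : xket b 0 0 = z by case: (E b).
have E1 b : xket b 1 0 = if b then z else - z by case: (E b).
rewrite braket2 !mulmx_cV2 !E0 !E1 {E E0 E1}.
(* The phase disappears here: |z|^2 factors out and the basis vectors survive only as signs. *)
have -> : (Num.conj z * (pauli R a 0 0 * z + pauli R a 0 1 * (if b2 then z else - z)) +
  Num.conj (if b1 then z else - z) *
    (pauli R a 1 0 * z + pauli R a 1 1 * (if b2 then z else - z))) =
  Num.conj z * z * ((pauli R a 0 0 + pauli R a 0 1 * (-1) ^+ (~~ b2)) +
    (-1) ^+ (~~ b1) * (pauli R a 1 0 + pauli R a 1 1 * (-1) ^+ (~~ b2))).
  have -> : Num.conj (if b1 then z else - z) = (-1) ^+ (~~ b1) * Num.conj z.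
    by case: b1; rewrite ?expr0 ?mul1r // rmorphN expr1 mulN1r.
  have -> : (if b2 then z else - z) = (-1) ^+ (~~ b2) * z.
    by case: b2; rewrite ?expr0 ?mul1r // expr1 mulN1r.
  move: (pauli R a) (Num.conj z) => M w.
  move: (M 0 0) (M 0 1) (M 1 0) (M 1 1) ((-1) ^+ _) ((-1) ^+ _) => *.
  ring.
(* Since |z|^2 = 1/2, two equal contributions add up to exactly one; in the remaining cases they
   cancel. *)
have two c : Num.conj z * z * (c + c) = c by rewrite mulrDr -mulrDl zz mul1r.
case: a b1 b2 => [] [] [];
  rewrite /= ?mxE /= ?complexiE ?expr0 ?expr1 ?mulN1r ?mulrN1 ?mulr1 ?mul1r ?mul0r
    ?addr0 ?add0r ?opprK ?subr0 ?subrr ?addNr ?mulr0 ?two //.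
Qed.

Lemma norm_braket_pauli a b1 b2 :
  `|braket (xket b1) (pauli R a *m xket b2)| = (b1 == b2 (+) flips a)%:R.
Proof.
rewrite braket_pauli; case: eqP => _; last by rewrite normr0.
by case: a; rewrite ?normrM ?normrX ?normrN1 ?normr1 ?expr1n ?mulr1 ?normCi.
Qed.

End XBasis.

(** * Combinatorics of kink patterns on an odd ring *)

Section KinkConfigurations.
Variable N : nat.
Hypothesis oddN : odd N.

Lemma kink_plus_bond (j : nat) (i : 'I_N) : (0 < j <= N)%N ->
  (kink_plus j i == kink_plus j (ordS i)) = (i.+1 == j).
Proof.
move=> /(kink_plus_ordS i oddN); case: eqP => _; last by move/negPf.
by case/andP => -> ->.
Qed.

(** Whether the spins at the two ends of a bond agree is insensitive to a global reversal, and to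
    [f] when [f] has equal values at both ends; agreement is what marks the kink. *)
Lemma kink_plus_match (f : 'I_N -> bool) (j1 j2 : nat) (e1 e2 : bool) (i : 'I_N) :
  (0 < j1 <= N)%N -> (0 < j2 <= N)%N ->
  (forall i, kink_plus j1 i (+) e1 = kink_plus j2 i (+) e2 (+) f i) ->
  f i = f (ordS i) -> (i.+1 == j1) = (i.+1 == j2).
Proof.
move=> j1N j2N E fi; rewrite -!kink_plus_bond //.
have := E i; have := E (ordS i); rewrite -{}fi {E}.
by case: (f i) e1 e2 (kink_plus j1 i) (kink_plus j2 i)
  (kink_plus j1 (ordS i)) (kink_plus j2 (ordS i)) => [] [] [] [] [] [] [].
Qed.

Lemma kink_plus_inj (j1 j2 : nat) (e1 e2 : bool) :
  (0 < j1 <= N)%N -> (0 < j2 <= N)%N ->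
  (forall i : 'I_N, kink_plus j1 i (+) e1 = kink_plus j2 i (+) e2) ->
  j1 = j2 /\ e1 = e2.
Proof.
move=> j1N j2N E.
(* The ordinal [j1.-1] is site [j1], the left end of the kink bond. Comparing the patterns across
   this bond identifies the kinks; comparing them at this site then identifies the reversals. *)
have i1N : (j1.-1 < N)%N by lia.
have j12 : j1 = j2.
  have := @kink_plus_match xpred0 _ _ e1 e2 (Ordinal i1N) j1N j2N.
  rewrite /= prednK ?eqxx; last by lia.
  by move=> /(_ _ erefl)/esym/eqP; apply=> i; rewrite addbF.
by split=> //; move: (Ordinal i1N) => i; have := E i; rewrite j12 => /addbI.
Qed.

(* If f is constant across the bond of the kink j1, then j2 = j1, so that f is
   constant; but f vanishes off the first L sites and not at i0. *)
Lemma kink_plus_localized (f : 'I_N -> bool) (L j1 j2 : nat) (e1 e2 : bool)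
    (i0 : 'I_N) :
  (forall i : 'I_N, (L <= i)%N -> f i = false) -> f i0 ->
  (0 < j1 <= N)%N -> (0 < j2 <= N)%N ->
  (forall i, kink_plus j1 i (+) e1 = kink_plus j2 i (+) e2 (+) f i) ->
  (j1 <= L)%N || (j1 == N).
Proof.
move=> f0 fi0 j1N j2N E; apply: contraT; rewrite negb_or -ltnNge => /andP[Lj1 j1'].
have i1N : (j1.-1 < N)%N by lia.
have LN : (L < N)%N by lia.
have j12 : j1 = j2.
  have := kink_plus_match (i := Ordinal i1N) j1N j2N E.
  rewrite /= prednK ?eqxx; last by lia.
  move=> H; apply/eqP; rewrite -H // !f0 //=; last by lia.
  by rewrite prednK ?modn_small; lia.
have := E (Ordinal LN); have := E i0; rewrite j12 fi0 f0 // {E}.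
by move: (kink_plus j2 _) (kink_plus j2 _) e1 e2 => [] [] [] [].
Qed.

(** With [i < j] neither residue wraps around, and the two differ by one. Hence a kink lying beyond
    the string reverses all spins of the string when it advances. *)
Lemma kink_plusS (j : nat) (i : 'I_N) :
  (i < j)%N -> (j < N)%N -> kink_plus j.+1 i = ~~ kink_plus j i.
Proof.
move=> ij jN; rewrite /kink_plus !modn_small; lia.
Qed.

End KinkConfigurations.

(** * Sesquilinearity of the inner product *)

Section Braket.
Variables (R : realType) (n : nat).
Implicit Types u v : 'cV[R[i]]_n.

Lemma braketZl c u v : braket (c *: u) v = Num.conj c * braket u v.
Proof. by rewrite /braket linearZ /= map_mxZ -scalemxAl mxE. Qed.

Lemma braketZr c u v : braket u (c *: v) = c * braket u v.
Proof. by rewrite /braket -scalemxAr mxE. Qed.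

Lemma braket_suml (I : Type) (r : seq I) (P : pred I) (F : I -> 'cV[R[i]]_n) v :
  braket (\sum_(i <- r | P i) F i) v = \sum_(i <- r | P i) braket (F i) v.
Proof. by rewrite /braket linear_sum raddf_sum mulmx_suml summxE. Qed.

Lemma braket_sumr (I : Type) (r : seq I) (P : pred I) (F : I -> 'cV[R[i]]_n) u :
  braket u (\sum_(i <- r | P i) F i) = \sum_(i <- r | P i) braket u (F i).
Proof. by rewrite /braket mulmx_sumr summxE. Qed.

End Braket.

(** * Expansion of matrix elements over kink positions and reversals *)

Section MatrixElements.
Variables (R : realType) (N : nat) (ketp ketm : 'cV[R[i]]_2).
Hypothesis hket : x_eigenbasis ketp ketm.

(** The boolean [e] records whether the parity operator has acted, so that both terms of a ground
    state become one sum over [e]. *)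
Definition flip_kink (e : bool) (j : nat) : state R N :=
  tensor_ket (fun i : 'I_N => xket ketp ketm (kink_plus j i (+) e)).

Lemma kink_groundE u v p :
  kink_ground N ketp ketm u v p =
  ((Num.sqrt N%:R)^-1)%:C *: \sum_(1 <= j < N.+1) \sum_(e : bool)
    (expi (p * j%:R) * (if e then v else u)) *: flip_kink e j.
Proof.
rewrite /kink_ground /kink_momentum -scalemxAr mulmx_sumr; congr (_ *: _).
apply: eq_bigr => j _; rewrite -scalemxAr big_bool /= -!scalerA -scalerDr.
congr (_ *: _); rewrite mulmxDl mul_scalar_mx -scalemxAl tensor_op_ket addrC.
congr (_ *: _ + _ *: _); apply/colP => s; rewrite !mxE; apply: eq_bigr => i _.
  by rewrite -/(xket _ _ _) (pauli_Pz_xket hket) addbT.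
by rewrite -/(xket _ _ _) addbF.
Qed.

Section Amplitude.
Variable a : nat -> pauli_label.

Definition amplitude (e1 : bool) (j1 : nat) (e2 : bool) (j2 : nat) : R[i] :=
  braket (flip_kink e1 j1) (tensor_op (fun i : 'I_N => pauli R (a i)) *m flip_kink e2 j2).

Lemma amplitudeE e1 j1 e2 j2 : amplitude e1 j1 e2 j2 =
  \prod_(i < N) braket (xket ketp ketm (kink_plus j1 i (+) e1))
    (pauli R (a i) *m xket ketp ketm (kink_plus j2 i (+) e2)).
Proof. by rewrite /amplitude tensor_op_ket braket_tensor_ket. Qed.

(** Each site contributes a factor of modulus 0 or 1, and a single mismatch kills the product. *)
Lemma norm_amplitude e1 j1 e2 j2 : `|amplitude e1 j1 e2 j2| =
  [forall i : 'I_N, kink_plus j1 i (+) e1 ==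
     kink_plus j2 i (+) e2 (+) flips (a i)]%:R.
Proof.
rewrite amplitudeE normr_prod.
under eq_bigr do rewrite (norm_braket_pauli hket).
case: forallP => [E|/forallP/forallPn[i /negPf Ei]]; last first.
  by rewrite (bigD1 i) //= Ei mul0r.
by rewrite big1 // => i _; rewrite E.
Qed.

Lemma braket_kink_ground (u1 v1 u2 v2 : R[i]) (p1 p2 : R) :
  braket (kink_ground N ketp ketm u1 v1 p1)
    (tensor_op (fun i : 'I_N => pauli R (a i)) *m kink_ground N ketp ketm u2 v2 p2) =
  N%:R^-1 * \sum_(1 <= j1 < N.+1) \sum_(e1 : bool)
    \sum_(1 <= j2 < N.+1) \sum_(e2 : bool)
    Num.conj (expi (p1 * j1%:R) * (if e1 then v1 else u1)) *
    (expi (p2 * j2%:R) * (if e2 then v2 else u2)) * amplitude e1 j1 e2 j2.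
Proof.
rewrite !kink_groundE -scalemxAr braketZl braketZr mulrA.
(* The two real normalizations combine into the factor 1/N. *)
have -> : Num.conj ((Num.sqrt N%:R)^-1)%:C * ((Num.sqrt N%:R)^-1)%:C = N%:R^-1 :> R[i].
  rewrite -[Num.conj _]/((_ : R[i])^*) conjc_real -rmorphM /= -invfM -expr2.
  by rewrite sqr_sqrtr ?ler0n // fmorphV rmorph_nat.
congr (_ * _); rewrite braket_suml; apply: eq_bigr => j1 _.
rewrite braket_suml; apply: eq_bigr => e1 _; rewrite braketZl.
rewrite mulmx_sumr braket_sumr mulr_sumr; apply: eq_bigr => j2 _.
rewrite mulmx_sumr braket_sumr mulr_sumr; apply: eq_bigr => e2 _.
by rewrite -scalemxAr braketZr mulrA.
Qed.

End Amplitude.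
End MatrixElements.

(** * Phases and momenta *)

Section Phases.
Variable R : realType.
Implicit Types x y p : R.

Lemma expiD x y : expi (x + y) = expi x * expi y.
Proof. by rewrite /expi cosD sinD; simpc; rewrite [sin x * cos y + _]addrC. Qed.

Lemma expi_nat x n : expi (x * n%:R) = expi x ^+ n.
Proof.
elim: n => [|n IHn]; first by rewrite mulr0 /expi cos0 sin0 expr0.
by rewrite -natr1 mulrDr mulr1 expiD IHn exprSr.
Qed.

Lemma norm_expi x : `|expi x| = 1.
Proof. by rewrite normc_def /= cos2Dsin2 sqrtr1. Qed.

Lemma expi_momentum N k : (0 < N)%N -> expi (momentum R N k) ^+ N = 1.
Proof.
move=> N0; rewrite -expi_nat /momentum divfK ?pnatr_eq0 -?lt0n // expi_nat.
by rewrite mulr_natl /expi cos2pi sin2pi expr1n.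
Qed.

(** Half-angle factorization: 1 + e^{ix} = 2 cos(x/2) e^{ix/2}. *)
Lemma norm1Dexpi x : `|1 + expi x| = 2 * (`|cos (x / 2)|)%:C.
Proof.
have -> : 1 + expi x = 2 * (cos (x / 2))%:C * expi (x / 2).
  rewrite -{1}[x](@divfK _ 2) ?pnatr_eq0 // mulr_natr /expi cos_mulr2n sin_mulr2n.
  apply/eqP; rewrite eq_complex /=; apply/andP; split; apply/eqP; simpc.
    ring.
  ring.
rewrite !normrM norm_expi mulr1 normr_nat; congr (_ * _).
by rewrite normc_def /= expr0n addr0 sqrtr_sqr.
Qed.

End Phases.

(** * Geometric sums with alternating coefficients *)

Section AlternatingSum.
Variables (R : realType) (z : R[i]) (s : nat -> R[i]) (L N : nat).
Hypotheses (LN : (L <= N)%N) (norm_z : `|z| = 1) (norm_s : forall j, `|s j| <= 1).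
Hypothesis s_alt : forall j, (L <= j < N)%N -> s j.+1 = - s j.

(** Telescoping: z^{j+1} s_j from one term cancels z^{j+1} s_{j+1} from the next, so only the two
    boundary terms remain. *)
Lemma alternating_geometric_sum :
  (1 + z) * \sum_(L <= j < N.+1) z ^+ j * s j = z ^+ L * s L + z ^+ N.+1 * s N.
Proof.
have H m : (L + m <= N)%N -> (1 + z) * \sum_(L <= j < (L + m).+1) z ^+ j * s j =
    z ^+ L * s L + z ^+ (L + m).+1 * s (L + m)%N.
  elim: m => [|m IHm] mN.
    by rewrite addn0 big_nat1 mulrDl mul1r mulrA -exprS.
  rewrite addnS big_nat_recr /=; last by rewrite -addnS leq_addr.
  rewrite mulrDr IHm; last by lia.
  rewrite s_alt; last by lia.
  rewrite mulrDl mul1r mulrA -exprS !mulrN -addrA; congr (_ + _).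
  by rewrite addrA subrr add0r.
by have := H (N - L)%N; rewrite subnKC // => ->.
Qed.

(** The first L-1 terms have no sign pattern and are bounded by 1 each; the others are controlled by
    the two boundary terms of the telescoped sum. *)
Lemma norm_alternating_sum : (0 < L)%N -> 1 + z != 0 ->
  `|\sum_(1 <= j < N.+1) z ^+ j * s j| <= (L.-1)%:R + 2 / `|1 + z|.
Proof.
move=> L0 z1.
have nzs k j : `|z ^+ k * s j| <= 1 by rewrite normrM normrX norm_z expr1n mul1r.
rewrite (@big_cat_nat _ _ _ L) //=; last exact: leq_trans LN _.
apply: le_trans (ler_normD _ _) _; apply: lerD.
  apply: le_trans (ler_norm_sum _ _ _) _.
  apply: le_trans (ler_sum _ (fun j _ => nzs j j)) _.
  by rewrite sumr_const_nat subn1.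
rewrite ler_pdivlMr ?normr_gt0 // -normrM mulrC alternating_geometric_sum.
by apply: le_trans (ler_normD _ _) _; rewrite -[2]/(1 + 1) lerD.
Qed.

End AlternatingSum.

Lemma sum_near_string (L N : nat) : (0 < N)%N ->
  (\sum_(1 <= j < N.+1) ((j <= L) || (j == N)) <= L.+1)%N.
Proof.
move=> N0; rewrite big_nat_recr //= eqxx orbT addn1 ltnS.
rewrite (@eq_big_nat _ _ _ _ _ _ (fun j => (j <= L)%N : nat)) => [|j jN]; last first.
  by rewrite (_ : (j == N) = false) ?orbF //; lia.
have H n : (\sum_(1 <= j < n.+1) (j <= L) = minn n L)%N.
  elim: n => [|n IHn]; first by rewrite big_nil min0n.
  by rewrite big_nat_recr //= IHn; lia.
by rewrite -(prednK N0) H geq_minr.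
Qed.

(** * The bounds on a fixed ring, first for strings that flip a spin *)

Section Bounds.
Variables (R : realType) (ketp ketm : 'cV[R[i]]_2)
  (L : nat) (alpha : 'I_L -> pauli_label).
Hypotheses (hket : x_eigenbasis ketp ketm) (L0 : (1 <= L)%N).
Variable N : nat.
Hypotheses (oddN : odd N) (LN : (L <= N)%N).
Variables (u1 v1 u2 v2 : R[i]).
Hypotheses (n1 : `|u1| ^+ 2 + `|v1| ^+ 2 = 1) (n2 : `|u2| ^+ 2 + `|v2| ^+ 2 = 1).

Let N0 : (0 < N)%N. Proof. exact: leq_trans LN. Qed.

Lemma norm_coef (u v : R[i]) (e : bool) :
  `|u| ^+ 2 + `|v| ^+ 2 = 1 -> `|if e then v else u| <= 1.
Proof.
move=> uv; rewrite -(@expr_le1 _ 2) //.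
by case: e; rewrite -uv ?lerDr ?lerDl exprn_ge0.
Qed.

(** Phases and coefficients have modulus at most 1, and a nonzero amplitude localizes both kinks.
    The bound is a product in [j1] and [j2], so that summing it gives a square. *)
Lemma norm_flipping_term (p1 p2 : R) (e1 e2 : bool) (j1 j2 : nat) (i0 : 'I_L) :
  flips (alpha i0) -> (0 < j1 <= N)%N -> (0 < j2 <= N)%N ->
  `|Num.conj (expi (p1 * j1%:R) * (if e1 then v1 else u1)) *
    (expi (p2 * j2%:R) * (if e2 then v2 else u2)) *
    amplitude N ketp ketm (pad alpha) e1 j1 e2 j2|
  <= ((j1 <= L)%N || (j1 == N))%:R * ((j2 <= L)%N || (j2 == N))%:R.
Proof.
move=> fi0 j1N j2N; rewrite !normrM norm_conjC normrM !norm_expi !mul1r.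
have := norm_coef e1 n1; have := norm_coef e2 n2; rewrite norm_amplitude //.
move: (if e1 then v1 else u1) (if e2 then v2 else u2) => w1 w2 w21 w11.
case: forallP => [E|_]; last by rewrite mulr0 mulr_ge0 ?ler0n.
have E1 i := eqP (E i).
(* Flipping is an involution, so the matching condition is symmetric and localization applies to
   [j2] as well. *)
have E2 (i : 'I_N) : kink_plus j2 i (+) e2 =
    kink_plus j1 i (+) e1 (+) flips (pad alpha i).
  by rewrite E1 -[RHS]addbA addbb addbF.
have f0 (i : 'I_N) : (L <= i)%N -> flips (pad alpha i) = false.
  by move=> Li; rewrite pad_ge.
have fi0' : flips (pad alpha (widen_ord LN i0)) by rewrite pad_ord.
have -> := kink_plus_localized oddN f0 fi0' j1N j2N E1.
have -> := kink_plus_localized oddN f0 fi0' j2N j1N E2.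
by rewrite !mulr1 mulr_ile1.
Qed.

Lemma norm_braket_flipping (p1 p2 : R) :
  (exists j, flips (alpha j)) ->
  `|braket (kink_ground N ketp ketm u1 v1 p1)
     (pauli_string R N alpha *m kink_ground N ketp ketm u2 v2 p2)|
  <= (2 * L.+1%:R) ^+ 2 / N%:R.
Proof.
case=> i0 fi0; rewrite pauli_stringE // braket_kink_ground // mulrC normrM.
rewrite normfV normr_nat ler_wpM2r ?invr_ge0 ?ler0n //.
pose near j : R[i] := ((j <= L)%N || (j == N))%:R.
pose S := \sum_(1 <= j < N.+1) \sum_(e : bool) near j.
have near_ge0 j : 0 <= near j by rewrite ler0n.
(* Each factor [S] is at most 2(L+1): two reversals for each of at most L+1 positions. *)
apply: (@le_trans _ _ (S * S)); last first.
  have S0 : 0 <= S by apply: sumr_ge0 => j _; apply: sumr_ge0.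
  suff : S <= 2 * L.+1%:R by move=> SL; rewrite expr2 ler_pM.
  rewrite /S; under eq_bigr do rewrite big_bool /= -mulr2n.
  by rewrite sumrMnl -[leLHS]mulr_natl -natr_sum
    ler_wpM2l ?ler0n // ler_nat sum_near_string.
rewrite mulr_suml; apply: le_trans (ler_norm_sum _ _ _) _.
apply: ler_sum_nat => j1 j1N; rewrite mulr_suml.
apply: le_trans (ler_norm_sum _ _ _) _; apply: ler_sum => e1 _; rewrite mulr_sumr.
apply: le_trans (ler_norm_sum _ _ _) _; apply: ler_sum_nat => j2 j2N; rewrite mulr_sumr.
apply: le_trans (ler_norm_sum _ _ _) _; apply: ler_sum => e2 _.
exact: norm_flipping_term fi0 _ _.
Qed.

(** * Strings of identities and an odd number of sigma^x *)

Section Diagonal.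
Hypothesis alpha_diag : forall j, alpha j = P0 \/ alpha j = Px.
Hypothesis odd_x : odd #|[pred j | alpha j == Px]|.

Let A (e : bool) (j : nat) : R[i] := amplitude N ketp ketm (pad alpha) e j e j.

Lemma pad_diag n : pad alpha n = P0 \/ pad alpha n = Px.
Proof. by rewrite /pad; case: insubP => [j _ _|]; [exact: alpha_diag|left]. Qed.

Lemma flips_diag n : flips (pad alpha n) = false.
Proof. by case: (pad_diag n) => ->. Qed.

(** Advancing the kink reverses every spin of the string, so each sigma^x changes the sign of its
    eigenvalue, and their number is odd. *)
Lemma amplitude_alternates e j : (L <= j < N)%N -> A e j.+1 = - A e j.
Proof.
move=> /andP[Lj jN]; rewrite /A !amplitudeE.
(* Writing -1 as a product over all sites lets the two amplitudes be compared site by site. *)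
have sign : \prod_(i < N) (if pad alpha i == Px then -1 else 1) = -1 :> R[i].
  rewrite -big_mkcond prodr_const -signr_odd.
  suff -> : #|[pred i : 'I_N | pad alpha i == Px]| = #|[pred j | alpha j == Px]|.
    by rewrite odd_x expr1.
  rewrite -!sum1_card [RHS](eq_bigl (fun j : 'I_L => pad alpha j == Px)); last first.
    by move=> k; rewrite pad_ord.
  rewrite [RHS](big_ord_widen_cond N (fun n => pad alpha n == Px) (fun=> 1%N)) //.
  apply: eq_big => // i; rewrite inE; have [Li|Li] := ltnP i L; first by rewrite andbT.
  by rewrite pad_ge.
rewrite -mulN1r -sign -big_split; apply: eq_bigr => i _.
rewrite !(braket_pauli hket) flips_diag !addbF !eqxx.
have [Li|iL] := leqP L i; first by rewrite pad_ge //= mul1r.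
case: (pad_diag i) => -> /=; first by rewrite mul1r.
rewrite kink_plusS //; last exact: leq_trans Lj.
by case: (kink_plus j i) e => [] []; rewrite /= ?expr0 ?expr1 ?mulrNN ?mulr1.
Qed.

Lemma amplitude_offdiag e1 j1 e2 j2 : (0 < j1 <= N)%N -> (0 < j2 <= N)%N ->
  amplitude N ketp ketm (pad alpha) e1 j1 e2 j2 != 0 -> j1 = j2 /\ e1 = e2.
Proof.
move=> j1N j2N; rewrite -normr_eq0 norm_amplitude //.
case: forallP => [E _|]; last by rewrite eqxx.
by apply: kink_plus_inj j1N j2N _ => // i; have/eqP := E i; rewrite flips_diag addbF.
Qed.

Lemma norm_amplitude_le1 e j : `|A e j| <= 1.
Proof. by rewrite norm_amplitude // lern1 leq_b1. Qed.

Lemma braket_diag (p1 p2 : R) :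
  braket (kink_ground N ketp ketm u1 v1 p1)
    (pauli_string R N alpha *m kink_ground N ketp ketm u2 v2 p2) =
  N%:R^-1 * \sum_(e : bool)
    Num.conj (if e then v1 else u1) * (if e then v2 else u2) *
    \sum_(1 <= j < N.+1) expi (p2 - p1) ^+ j * A e j.
Proof.
rewrite pauli_stringE // braket_kink_ground //; congr (_ * _).
rewrite exchange_big; apply: eq_bigr => e1 _; rewrite mulr_sumr.
apply: eq_big_nat => j1 j1N.
(* Orthogonality leaves only [j2 = j1], and then only [e2 = e1]; the two phases merge into a power
   of e^{i(p2-p1)}. *)
rewrite (bigD1_seq j1) ?iota_uniq ?mem_index_iota //=.
rewrite [X in _ + X]big_nat_cond [X in _ + X]big1 ?addr0; last first.
  move=> j2 /andP[j2N j21]; apply: big1 => e2 _.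
  have [-> | /(amplitude_offdiag j1N j2N)[j12]] :=
    eqVneq (amplitude N ketp ketm (pad alpha) e1 j1 e2 j2) 0.
    by rewrite mulr0.
  by rewrite j12 eqxx in j21.
rewrite (bigD1 e1) //= big1 ?addr0; last first.
  move=> e2 e21.
  have [-> | /(amplitude_offdiag j1N j1N)[_ e12]] :=
    eqVneq (amplitude N ketp ketm (pad alpha) e1 j1 e2 j1) 0.
    by rewrite mulr0.
  by rewrite e12 eqxx in e21.
have conj_expi x : Num.conj (expi x) = expi (- x).
  by rewrite /expi cosN sinN.
rewrite -/(A e1 j1) !expi_nat !rmorphM !rmorphXn /= conj_expi addrC expiD exprMn.
move: (_ ^+ _) (_ ^+ _) (Num.conj _) (if e1 then v2 else u2) (A _ _) => x y w1 w2 t.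
ring.
Qed.

Lemma norm_braket_diag (p1 p2 : R) :
  (exists k : 'I_N, p1 = momentum R N k) ->
  (exists k : 'I_N, p2 = momentum R N k) ->
  `|braket (kink_ground N ketp ketm u1 v1 p1)
     (pauli_string R N alpha *m kink_ground N ketp ketm u2 v2 p2)|
  <= ((2 * L%:R) / (N%:R * `|cos ((p1 - p2) / 2)|))%:C.
Proof.
move=> [k1 pk1] [k2 pk2].
set c := `|cos ((p1 - p2) / 2)|; pose z := expi (p2 - p1).
have zc : `|1 + z| = 2 * c%:C.
  by rewrite norm1Dexpi -opprB mulNr cosN.
(* [z] is an N-th root of unity, whereas (-1)^N = -1 for odd N. Hence the cosine is nonzero and the
   bound is a genuine quotient. *)
have z1 : 1 + z != 0.
  apply/eqP => z0.
  have zN : z ^+ N = 1.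
    have : expi p1 ^+ N * z ^+ N = expi p2 ^+ N.
      by rewrite -exprMn -expiD addrC subrK.
    by rewrite pk1 pk2 !expi_momentum // mul1r.
  move: zN; rewrite (_ : z = -1); last by apply/eqP; rewrite -addr_eq0 addrC z0.
  rewrite -signr_odd oddN expr1 => /eqP; rewrite eq_sym -addr_eq0.
  by rewrite -[1 + 1]/(2%:R) pnatr_eq0.
have c0 : 0 < c.
  rewrite lt_neqAle normr_ge0 andbT eq_sym; apply: contra z1 => /eqP c0.
  by rewrite -normr_eq0 zc c0 mulr0.
have c1 : c <= 1.
  by rewrite ler_norml cos_geN1 cos_le1.
(* Here 2/|1+z| = 1/c, and c <= 1 allows L-1 to be absorbed as (L-1)/c. *)
have E : L.-1%:R + 2 / `|1 + z| <= (L%:R / c)%:C.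
  have -> : L.-1%:R + 2 / `|1 + z| = (L.-1%:R + c^-1)%:C.
    rewrite zc invfM mulrA mulfV ?pnatr_eq0 // mul1r.
    by rewrite rmorphD rmorph_nat fmorphV.
  rewrite lecR -[in leRHS](prednK L0) -natr1 mulrDl mul1r lerD2r.
  by rewrite ler_peMr ?ler0n // invf_ge1.
rewrite braket_diag normrM normfV normr_nat.
have -> : (2 * L%:R / (N%:R * c))%:C = N%:R^-1 * (2 * (L%:R / c)%:C).
  rewrite -(rmorph_nat (@real_complex R) N) -fmorphV -(rmorph_nat (@real_complex R) 2).
  rewrite -!rmorphM; congr (_%:C); rewrite invfM; ring.
rewrite ler_wpM2l ?invr_ge0 ?ler0n //.
(* The factor 2 is spent on the two values of the reversal [e]. *)
have -> x : 2 * x = \sum_(e : bool) x :> R[i] by rewrite big_bool mulr_natl mulr2n.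
apply: le_trans (ler_norm_sum _ _ _) _; apply: ler_sum => e _.
rewrite normrM -[leRHS]mul1r ler_pM //.
  by rewrite normrM norm_conjC mulr_ile1 // norm_coef.
apply: le_trans E; apply: norm_alternating_sum => // [|j|j].
- exact: norm_expi.
- exact: norm_amplitude_le1.
- exact: amplitude_alternates.
Qed.

End Diagonal.
End Bounds.

Theorem theorem1 (R : realType) (ketp ketm : 'cV[R[i]]_2)
    (hket : x_eigenbasis ketp ketm)
    (L : nat) (hL : (1 <= L)%N) (alpha : 'I_L -> pauli_label) :
  exists C1 C2 : R, 0 < C1 /\ 0 < C2 /\
    forall N : nat, odd N -> (L <= N)%N ->
    forall p1 p2 : R,
      (exists k : 'I_N, p1 = momentum R N k) ->
      (exists k : 'I_N, p2 = momentum R N k) ->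
    forall u1 v1 u2 v2 : R[i],
      `|u1| ^+ 2 + `|v1| ^+ 2 = 1 -> `|u2| ^+ 2 + `|v2| ^+ 2 = 1 ->
    let g1 := kink_ground N ketp ketm u1 v1 p1 in
    let g2 := kink_ground N ketp ketm u2 v2 p2 in
    let A := pauli_string R N alpha in
    ((forall j, alpha j = P0 \/ alpha j = Px) ->
     odd #|[pred j | alpha j == Px]| ->
     `|braket g1 (A *m g2)|
       <= (C1 / (N%:R * `|cos ((p1 - p2) / 2)|))%:C) /\
    ((exists j, alpha j = Py \/ alpha j = Pz) ->
     `|braket g1 (A *m g2)| <= (C2 / N%:R)%:C).
Proof.
(* In both constants the 2 counts the reversals of a kink state: once in the diagonal case, where
   they must agree, and once per state in the flipping case. *)
exists (2 * L%:R), ((2 * L.+1%:R) ^+ 2); do 2?split.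
- by rewrite mulr_gt0 ?ltr0n.
- by rewrite exprn_gt0 // mulr_gt0 ?ltr0n.
move=> N oddN LN p1 p2 p1k p2k u1 v1 u2 v2 n1 n2 g1 g2 A; split.
  by move=> alpha_diag odd_x; apply: norm_braket_diag.
case=> j alpha_j; apply: le_trans (norm_braket_flipping hket hL oddN LN n1 n2 p1 p2 _) _.
  by exists j; case: alpha_j => ->.
by rewrite fmorph_div rmorphXn rmorphM !rmorph_nat.
Qed.
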